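(* Let $T>0$, $s\ge0$, $\Omega_x=[-\pi,\pi]$. Let $v(t,x)$ be the exact solution, on the interval $t\in[0,T]$, of the convection equation with imaginary wave speed and periodic boundary condition $$\partial_tv=i\,\partial_xv\ \text{ in }\Omega_x,\qquad v(0,\cdot)=v_0,$$ and let $w(t,x,p)$ be the exact solution on $[0,T]$ of its Schrödingerised equation $$\partial_tw=-i\,\partial_{xp}w\ \text{ in }\Omega_x\times(-\infty,\infty),\qquad w(0,x,p)=e^{-|p|}v_0(x),$$ that is, $w(t,x,p)=\int_{\mathbb{R}}e^{-|p-\eta t|}\hat v_0(\eta)e^{-ix\eta}\,d\eta$. Write $v_T=v(T,\cdot)$ and suppose there is an a priori bound on $\|v_T\|_{H^s(\Omega_x)}$. For $\eta_{\max}>0$ let $\chi_{\max}$ be the characteristic function of $[-\eta_{\max},\eta_{\max}]$, let $$w_{\eta_{\max}}(t,x,p)=\int_{\mathbb{R}}e^{-|p-\eta t|}\hat v_0(\eta)\chi_{\max}(\eta)e^{-ix\eta}\,d\eta,$$ and define, for $p>p^{\Diamond}:=\eta_{\max}T$, the truncated solution by either one of the formulas $$v_{\eta_{\max}}(t,x,p)=e^{p}\,w_{\eta_{\max}}(t,x,p)\qquad\text{or}\qquad v_{\eta_{\max}}(t,x,p)=e^{p}\int_p^\infty w_{\eta_{\max}}(t,x,q)\,dq .$$ Let $v_{\eta_{\max},T}=v_{\eta_{\max}}(T,x,p)$ with $p>p^{\Diamond}=\eta_{\max}T$. Then $$\|v_T-v_{\eta_{\max},T}\|_{L^2(\Omega_x)}\le\frac{\delta(\eta_{\max})}{\eta_{\max}^s},\qquad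 \delta(\eta_{\max})=\Big(\int_{\eta_{\max}}^{\infty}(1+\eta^2)^s|\hat v_T(\eta)|^2\,d\eta\Big)^{1/2}.$$
   Context: $\hat g$ denotes the Fourier transform in $x$, with the convention $\hat g(\eta)=\frac1{2\pi}\int e^{ix\eta}g(x)\,dx$, $g(x)=\int_{\mathbb{R}}e^{-ix\eta}\hat g(\eta)\,d\eta$, and $\|g\|_{H^s(\Omega_x)}=\big(\int_{\mathbb{R}}|\hat g(\eta)|^2(1+\eta^2)^s\,d\eta\big)^{1/2}$, the $L^2(\Omega_x)$ norm being the case $s=0$. Since functions of $x$ here are $2\pi$-periodic, $\hat g(\eta)$ is to be read as the Fourier coefficient at the integer $\eta$ (the $x$-integral being taken over one period), and integrals in $\eta$ as sums over the integers $\eta$ in the range of integration.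
   Formalization: The bound is proved with δ summed over |η|>η_max (both sides); with the displayed one-sided δ only if v̂_0(η)=0 for η<−η_max. As displayed it fails: v_0=e^{iNx}, N>η_max, gives δ=0 but a nonzero error. *)

(* Defs.v *)
From HB Require Import structures.
From mathcomp Require Import all_boot all_order all_algebra.
From mathcomp Require Import all_classical all_reals all_analysis.
From mathcomp.real_closed Require Import complex.
Set Implicit Arguments.
Unset Strict Implicit.
Unset Printing Implicit Defensive.
Import Order.TTheory GRing.Theory Num.Theory.
Import numFieldNormedType.Exports.
Local Open Scope classical_set_scope.
Local Open Scope ring_scope.
Local Open Scope complex_scope.

Section ComplexCalculus.
Variable R : realType.

Definition cexpi (y : R) : R[i] := cos y +i* sin y.

Definition cintegral (D : set R) (g : R -> R[i]) : R[i] :=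
  Rintegral (@lebesgue_measure R) D (fun x => complex.Re (g x)) +i*
  Rintegral (@lebesgue_measure R) D (fun x => complex.Im (g x)).

Definition has_cderive (F : R -> R[i]) (t : R) (l : R[i]) : Prop :=
  is_derive t 1 (fun r => complex.Re (F r)) (complex.Re l) /\
  is_derive t 1 (fun r => complex.Im (F r)) (complex.Im l).

Definition ccontinuous_on (D : set R) (F : R -> R[i]) : Prop :=
  {within D, continuous (fun r => complex.Re (F r))} /\
  {within D, continuous (fun r => complex.Im (F r))}.

Definition smooth (f : R -> R) : Prop :=
  forall (n : nat) (x : R), derivable (derive1n n f) x 1.

End ComplexCalculus.

Section FourierSeries.
Variable R : realType.

Definition Omega : set R := `[- pi, pi].

(* A function on the circle is a 2pi-periodic function on the whole line. *)
Definition periodic_L2 (g : R -> R[i]) : Prop :=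
  [/\ periodic g (2 * pi),
      measurable_fun Omega (fun x => complex.Re (g x)),
      measurable_fun Omega (fun x => complex.Im (g x)) &
      (@lebesgue_measure R).-integrable Omega
        (fun x => (Normc.normc (g x) ^+ 2)%:E)].

(* The sign convention makes the synthesis formula
   g x = \sum_k fourier g k * cexpi (- (x * k)). *)
Definition fourier (g : R -> R[i]) (k : int) : R[i] :=
  ((2 * pi)^-1)%:C * cintegral Omega (fun x => cexpi (x * k%:~R) * g x).

(* Sums of nonnegative terms are taken in \bar R, so the value is +oo when the
   series diverges. *)
Definition Hnorm_on (A : set int) (s : R) (g : R -> R[i]) : \bar R :=
  poweR (\esum_(k in A)
    (Normc.normc (fourier g k) ^+ 2 * (1 + k%:~R ^+ 2) `^ s)%:E) 2^-1.

Definition Hnorm (s : R) (g : R -> R[i]) : \bar R := Hnorm_on [set: int] s g.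

Definition L2norm (g : R -> R[i]) : \bar R := Hnorm 0 g.

End FourierSeries.

Section Equations.
Variable R : realType.

(* Real test functions suffice: the pairing is bilinear, without conjugation. *)
Definition pairing (g : R -> R[i]) (phi : R -> R) : R[i] :=
  cintegral (@Omega R) (fun x => g x * (phi x)%:C).

Definition periodic_test (phi : R -> R) : Prop :=
  smooth phi /\ periodic phi (2 * pi).

Definition compact_test (psi : R -> R) : Prop :=
  smooth psi /\ exists M : R, forall p, M < `|p| -> psi p = 0.

(* Solutions of d_t v = i d_x v in the weak sense, in L^2 of the circle and
   weakly continuous in time: s = 0 is allowed in the theorem, so v need not be
   differentiable in x, and d_x is moved onto the test function. *)
Record convection_solution (T : R) (v0 : R -> R[i]) (v : R -> R -> R[i])
    : Prop := ConvectionSolution {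
  convection_L2 : forall t, 0 <= t <= T -> periodic_L2 (v t);
  convection_init : forall x, v 0 x = v0 x;
  convection_cont : forall phi, periodic_test phi ->
    ccontinuous_on `[0, T] (fun t => pairing (v t) phi);
  convection_eq : forall phi, periodic_test phi -> forall t, 0 < t < T ->
    has_cderive (fun r => pairing (v r) phi) t
      (- ('i * pairing (v t) (derive1 phi))) }.

Definition pairing2 (u : R -> R -> R[i]) (phi psi : R -> R) : R[i] :=
  cintegral [set: R] (fun p => pairing (fun x => u x p) phi * (psi p)%:C).

(* Solutions of d_t w = - i d_x d_p w. The kink of exp(-|p|) rules out classical
   solutions, so the equation is again weak; the two integrations by parts leave
   the sign unchanged. schrod_fourier is the explicit formula for w, read as an
   L^2 Fourier expansion in x (at t = 0 the series need not converge
   pointwise). *)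
Record schrodingerised_solution (T : R) (v0 : R -> R[i])
    (w : R -> R -> R -> R[i]) : Prop := SchrodingerisedSolution {
  schrod_L2 : forall t p, 0 <= t <= T -> periodic_L2 (fun x => w t x p);
  schrod_init : forall x p, w 0 x p = (expR (- `|p|))%:C * v0 x;
  schrod_cont : forall phi psi, periodic_test phi -> compact_test psi ->
    ccontinuous_on `[0, T] (fun t => pairing2 (w t) phi psi);
  schrod_eq : forall phi psi, periodic_test phi -> compact_test psi ->
    forall t, 0 < t < T ->
    has_cderive (fun r => pairing2 (w r) phi psi) t
      (- ('i * pairing2 (w t) (derive1 phi) (derive1 psi)));
  schrod_fourier : forall t p k, 0 <= t <= T ->
    fourier (fun x => w t x p) k =
      (expR (- `|p - k%:~R * t|))%:C * fourier v0 k }.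

(* The sum ranges over the finitely many k at which the characteristic function
   of [- eta_max, eta_max] is 1. *)
Definition w_trunc (eta_max : R) (v0 : R -> R[i]) (t x p : R) : R[i] :=
  \sum_(k \in [set k : int | `|k%:~R : R| <= eta_max])
    ((expR (- `|p - k%:~R * t|))%:C * fourier v0 k * cexpi (- (x * k%:~R))).

Definition recover_point (eta_max : R) (v0 : R -> R[i]) (t x p : R) : R[i] :=
  (expR p)%:C * w_trunc eta_max v0 t x p.

Definition recover_integral (eta_max : R) (v0 : R -> R[i]) (t x p : R) : R[i] :=
  (expR p)%:C * cintegral `]p, +oo[ (fun q => w_trunc eta_max v0 t x q).

Definition truncated_solution (T eta_max : R) (v0 : R -> R[i])
    (u : R -> R -> R -> R[i]) : Prop :=
  (forall t x p, 0 <= t <= T -> eta_max * T < p ->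
     u t x p = recover_point eta_max v0 t x p) \/
  (forall t x p, 0 <= t <= T -> eta_max * T < p ->
     u t x p = recover_integral eta_max v0 t x p).

(* The truncation removes the frequencies on both sides of
   [- eta_max, eta_max], so the tail for arbitrary data is two-sided. The
   one-sided tail does not bound the error in general: for v0 x = exp(iNx) with
   N > eta_max the only frequency is - N, hence delta_right is 0 while the error
   has norm exp(- N T). *)
Definition delta (s : R) (g : R -> R[i]) (eta_max : R) : \bar R :=
  Hnorm_on [set k : int | eta_max < `|k%:~R : R|] s g.

Definition delta_right (s : R) (g : R -> R[i]) (eta_max : R) : \bar R :=
  Hnorm_on [set k : int | eta_max < (k%:~R : R)] s g.

End Equations.

(* Main.v *)
(** The test functions cos (k x) and sin (k x) turn the weak convection equation
    into F' = k F for F t the k-th Fourier coefficient of v t, so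
    F T = exp (k T) F 0. For p > eta_max T every retained frequency satisfies
    k T < p, hence exp p * exp (- |p - k T|) = exp (k T), and integrating over
    ]p, +oo[ gives the same factor: both recovery formulas reproduce the
    retained modes of v T exactly. The error thus consists of the modes with
    |k| > eta_max, on which 1 <= eta_max ^ (- 2 s) * (1 + k ^ 2) ^ s. *)

Require Import Defs.
From HB Require Import structures.
From mathcomp Require Import all_boot all_order all_algebra.
From mathcomp Require Import finmap.
From mathcomp Require Import all_classical all_reals all_analysis.
From mathcomp Require Import ring lra.
From mathcomp.real_closed Require Import complex.
Set Implicit Arguments.
Unset Strict Implicit.
Unset Printing Implicit Defensive.
Import Order.TTheory GRing.Theory Num.Theory.
Import numFieldNormedType.Exports.
Local Open Scope classical_set_scope.
Local Open Scope ring_scope.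

(** * Integrals of complex-valued functions *)

Section ComplexIntegral.
Variable R : realType.
Local Open Scope complex_scope.
Implicit Types (z c : R[i]) (D : set (measurableTypeR R)) (g h : R -> R[i]).

Local Notation mu := (@lebesgue_measure R).

Lemma complex_ReD z c : complex.Re (z + c) = complex.Re z + complex.Re c.
Proof. by case: z c => [a b] [d e]. Qed.

Lemma complex_ImD z c : complex.Im (z + c) = complex.Im z + complex.Im c.
Proof. by case: z c => [a b] [d e]. Qed.

Lemma complex_ReM z c : complex.Re (z * c) =
  complex.Re z * complex.Re c - complex.Im z * complex.Im c.
Proof. by case: z c => [a b] [d e]. Qed.

Lemma complex_ImM z c : complex.Im (z * c) =
  complex.Re z * complex.Im c + complex.Im z * complex.Re c.
Proof. by case: z c => [a b] [d e]. Qed.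

Lemma complex_ext z c :
  complex.Re z = complex.Re c -> complex.Im z = complex.Im c -> z = c.
Proof. by case: z c => [a b] [d e] /= -> ->. Qed.

Lemma cexpiD (x y : R) : cexpi (x + y) = cexpi x * cexpi y.
Proof.
by apply: complex_ext; rewrite ?complex_ReM ?complex_ImM /= ?cosD ?sinD// addrC.
Qed.

Definition cintegrable D g :=
  mu.-integrable D (EFin \o (fun x => complex.Re (g x))) /\
  mu.-integrable D (EFin \o (fun x => complex.Im (g x))).

Lemma RintegrableZl D (a : R) (f : R -> R) : measurable D ->
  mu.-integrable D (EFin \o f) -> mu.-integrable D (EFin \o (fun x => a * f x)).
Proof.
by move=> mD fi; move: (integrableZl mD a fi); apply: eq_integrable.
Qed.

Lemma RintegrableD D (f1 f2 : R -> R) : measurable D ->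
  mu.-integrable D (EFin \o f1) -> mu.-integrable D (EFin \o f2) ->
  mu.-integrable D (EFin \o (fun x => f1 x + f2 x)).
Proof.
by move=> mD i1 i2; move: (integrableD mD i1 i2); apply: eq_integrable.
Qed.

Lemma RintegrableB D (f1 f2 : R -> R) : measurable D ->
  mu.-integrable D (EFin \o f1) -> mu.-integrable D (EFin \o f2) ->
  mu.-integrable D (EFin \o (fun x => f1 x - f2 x)).
Proof.
by move=> mD i1 i2; move: (integrableB mD i1 i2); apply: eq_integrable.
Qed.

Lemma cintegrableZ D c g : measurable D ->
  cintegrable D g -> cintegrable D (fun x => c * g x).
Proof.
move=> mD [ir ii]; split.
  rewrite (_ : (fun x => _) = (fun x => complex.Re c * complex.Re (g x) -
    complex.Im c * complex.Im (g x))); last first.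
    by apply/funext => x; rewrite complex_ReM.
  by apply: RintegrableB => //; exact: RintegrableZl.
rewrite (_ : (fun x => _) = (fun x => complex.Re c * complex.Im (g x) +
  complex.Im c * complex.Re (g x))); last by apply/funext => x; rewrite complex_ImM.
by apply: RintegrableD => //; exact: RintegrableZl.
Qed.

Lemma cintegrableD D g h : measurable D ->
  cintegrable D g -> cintegrable D h -> cintegrable D (fun x => g x + h x).
Proof.
move=> mD [gr gi] [hr hi]; split.
  rewrite (_ : (fun x => _) = fun x => complex.Re (g x) + complex.Re (h x)).
    exact: RintegrableD.
  by apply/funext => x; rewrite complex_ReD.
rewrite (_ : (fun x => _) = fun x => complex.Im (g x) + complex.Im (h x)).
  exact: RintegrableD.
by apply/funext => x; rewrite complex_ImD.
Qed.

Lemma cintegralZ D c g : measurable D -> cintegrable D g ->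
  cintegral D (fun x => c * g x) = c * cintegral D g.
Proof.
move=> mD [ir ii]; apply: complex_ext; rewrite ?complex_ReM ?complex_ImM /=.
  rewrite -!RintegralZl// -RintegralB//; try exact: RintegrableZl.
  by apply: eq_Rintegral => x _; rewrite complex_ReM.
rewrite -!RintegralZl// -RintegralD//; try exact: RintegrableZl.
by apply: eq_Rintegral => x _; rewrite complex_ImM.
Qed.

Lemma cintegralD D g h : measurable D -> cintegrable D g -> cintegrable D h ->
  cintegral D (fun x => g x + h x) = cintegral D g + cintegral D h.
Proof.
move=> mD [gr gi] [hr hi].
apply: complex_ext; rewrite ?complex_ReD ?complex_ImD /= -RintegralD//.
  by apply: eq_Rintegral => x _; rewrite complex_ReD.
by apply: eq_Rintegral => x _; rewrite complex_ImD.
Qed.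

Lemma cintegral0 D : measurable D -> cintegral D (fun=> 0) = 0.
Proof. by move=> mD; rewrite /cintegral/= Rintegral_cst// mul0r. Qed.

Lemma cintegrable_sum D (I : eqType) (r : seq I) (G : I -> R -> R[i]) :
  measurable D -> (forall j, j \in r -> cintegrable D (G j)) ->
  cintegrable D (fun x => \sum_(j <- r) G j x).
Proof.
move=> mD; elim: r => [_|j r IHr iG].
  under eq_fun do rewrite big_nil.
  by split; exact: integrable0.
under eq_fun do rewrite big_cons.
apply: cintegrableD => //; first exact: iG (mem_head j r).
by apply: IHr => i ir; apply: iG; rewrite in_cons ir orbT.
Qed.

Lemma cintegral_sum D (I : eqType) (r : seq I) (G : I -> R -> R[i]) :
  measurable D -> (forall j, j \in r -> cintegrable D (G j)) ->
  cintegral D (fun x => \sum_(j <- r) G j x) = \sum_(j <- r) cintegral D (G j).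
Proof.
move=> mD; elim: r => [_|j r IHr iG].
  by under eq_fun do rewrite big_nil; rewrite big_nil cintegral0.
under eq_fun do rewrite big_cons.
have iGr i : i \in r -> cintegrable D (G i).
  by move=> ir; apply: iG; rewrite in_cons ir orbT.
rewrite big_cons cintegralD ?IHr//; last exact: cintegrable_sum.
exact: iG (mem_head j r).
Qed.

Lemma eq_cintegral D g h : {in D, g =1 h} -> cintegral D g = cintegral D h.
Proof.
by move=> gh; congr (_ +i* _); apply: eq_Rintegral => x /gh ->.
Qed.

Lemma continuous_cintegrable (a b : R) g :
  continuous (fun x => complex.Re (g x)) ->
  continuous (fun x => complex.Im (g x)) -> cintegrable `[a, b] g.
Proof.
by move=> cr ci; split; apply: continuous_compact_integrable;
  [exact: segment_compact|exact: continuous_subspaceT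
  |exact: segment_compact|exact: continuous_subspaceT].
Qed.

Lemma periodic_L2_cintegrable g : periodic_L2 g -> cintegrable (@Omega R) g.
Proof.
move=> [_ mr mi i2].
have mO : measurable (@Omega R : set (measurableTypeR R)) by exact: measurable_itv.
have i1 : mu.-integrable (@Omega R)
    (fun x => (1%:E + (Normc.normc (g x) ^+ 2)%:E)%E).
  apply: integrableD => //.
  apply: (@continuous_compact_integrable R (fun=> 1) (@Omega R)).
    exact: segment_compact.
  by apply: continuous_subspaceT => x; exact: cvg_cst.
have sqD (a b : R) : `|a| <= `|1 + (a ^+ 2 + b ^+ 2)|.
  rewrite [leRHS]ger0_norm ?addr_ge0 ?sqr_ge0//.
  rewrite -(@real_normK _ a) ?num_real//.
  have := sqr_ge0 (`|a| - 1); have := sqr_ge0 b; have := sqr_ge0 `|a|; nra.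
have sqn z : Normc.normc z ^+ 2 = complex.Re z ^+ 2 + complex.Im z ^+ 2.
  by case: z => a b /=; rewrite sqr_sqrtr// addr_ge0 ?sqr_ge0.
split; apply: le_integrable i1 => //.
- exact/measurable_realfun.measurable_EFinP.
- by move=> x _ /=; rewrite lee_fin sqn; exact: sqD.
- exact/measurable_realfun.measurable_EFinP.
- by move=> x _ /=; rewrite lee_fin sqn [X in 1 + X]addrC; exact: sqD.
Qed.

Lemma continuous_mulr (a : R) : continuous (fun x : R => a * x).
Proof. by move=> x; apply: cvgM; [exact: cvg_cst|exact: cvg_id]. Qed.

Lemma continuous_cosM (a : R) : continuous (fun x : R => cos (a * x)).
Proof.
move=> x; apply: continuous_comp; [exact: continuous_mulr|exact: continuous_cos].
Qed.

Lemma continuous_sinM (a : R) : continuous (fun x : R => sin (a * x)).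
Proof.
move=> x; apply: continuous_comp; [exact: continuous_mulr|exact: continuous_sin].
Qed.

Lemma integrable_mul_bounded D (h f : R -> R) : measurable D ->
  continuous h -> (forall x, `|h x| <= 1) -> mu.-integrable D (EFin \o f) ->
  mu.-integrable D (EFin \o (fun x => h x * f x)).
Proof.
move=> mD ch h1 fi; apply: (integrableMr mD _ _ fi).
  by apply: measurable_funTS; exact: measurable_realfun.continuous_measurable_fun.
exists 1; split; first exact: num_real.
by move=> M M1 x Dx /=; exact: le_trans (h1 x) (ltW M1).
Qed.

Lemma cos_norm_le1 (x : R) : `|cos x| <= 1.
Proof. by rewrite ler_norml cos_geN1 cos_le1. Qed.

Lemma sin_norm_le1 (x : R) : `|sin x| <= 1.
Proof. by rewrite ler_norml sin_geN1 sin_le1. Qed.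

Lemma integrable_cosM D (a : R) (f : R -> R) : measurable D ->
  mu.-integrable D (EFin \o f) ->
  mu.-integrable D (EFin \o (fun x => cos (a * x) * f x)).
Proof.
move=> mD; apply: integrable_mul_bounded => // [|x]; last exact: cos_norm_le1.
exact: continuous_cosM.
Qed.

Lemma integrable_sinM D (a : R) (f : R -> R) : measurable D ->
  mu.-integrable D (EFin \o f) ->
  mu.-integrable D (EFin \o (fun x => sin (a * x) * f x)).
Proof.
move=> mD; apply: integrable_mul_bounded => // [|x]; last exact: sin_norm_le1.
exact: continuous_sinM.
Qed.

Lemma cintegrable_cexpi D (a : R) g : measurable D ->
  cintegrable D g -> cintegrable D (fun x => cexpi (x * a) * g x).
Proof.
move=> mD [gr gi]; split.
  rewrite (_ : (fun x => _) = (fun x => cos (a * x) * complex.Re (g x) -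
    sin (a * x) * complex.Im (g x))).
    by apply: RintegrableB; [|exact: integrable_cosM|exact: integrable_sinM].
  by apply/funext => x; rewrite complex_ReM/= ![x * a]mulrC.
rewrite (_ : (fun x => _) = (fun x => cos (a * x) * complex.Im (g x) +
  sin (a * x) * complex.Re (g x))).
  by apply: RintegrableD; [|exact: integrable_cosM|exact: integrable_sinM].
by apply/funext => x; rewrite complex_ImM/= ![x * a]mulrC.
Qed.

End ComplexIntegral.

(** * Fourier coefficients *)

Section FourierCoefficients.
Variable R : realType.
Local Open Scope complex_scope.

Local Notation mu := (@lebesgue_measure R).

Lemma measurable_Omega : measurable (@Omega R : set (measurableTypeR R)).
Proof. exact: measurable_itv. Qed.

#[local] Hint Resolve measurable_Omega : core.

Lemma is_derive_mulr (a x : R) : is_derive x 1 (fun y : R => a * y) a.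
Proof.
have : is_derive x 1 (a *: (id : R -> R)) (a *: 1) by exact: is_deriveZ.
by rewrite /GRing.scale/= mulr1.
Qed.

Lemma is_derive_sinM (a x : R) :
  is_derive x 1 (fun y => sin (a * y)) (a * cos (a * x)).
Proof.
rewrite mulrC.
exact: (is_derive1_comp (is_derive_sin (a * x)) (is_derive_mulr a x)).
Qed.

Lemma is_derive_cosM (a x : R) :
  is_derive x 1 (fun y => cos (a * y)) (- a * sin (a * x)).
Proof.
rewrite mulrC mulrN -mulNr.
exact: (is_derive1_comp (is_derive_cos (a * x)) (is_derive_mulr a x)).
Qed.

Lemma integral_derive (a b : R) (f F : R -> R) : a < b -> continuous f ->
  (forall x : R, is_derive x 1 F (f x)) ->
  Rintegral mu `[a, b] f = F b - F a.
Proof.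
move=> ab cf dF.
have cF : continuous F.
  by move=> x; apply: differentiable_continuous; apply/derivable1_diffP.
rewrite /Rintegral (@continuous_FTC2 _ f F)//.
- exact: continuous_subspaceT.
- split; first by move=> x _; exact: ex_derive.
  + by apply: cvg_at_right_filter; exact: cF.
  + by apply: cvg_at_left_filter; exact: cF.
- by move=> x _; rewrite derive1E derive_val.
Qed.

Lemma sin_intM_pi (m : int) : sin (m%:~R * pi) = 0 :> R.
Proof.
have sin_natM_pi (n : nat) : sin (n%:R * pi) = 0 :> R.
  elim: n => [|n IHn]; first by rewrite mul0r sin0.
  by rewrite -natr1 mulrDl mul1r sinDpi IHn oppr0.
case: m => n; first by rewrite sin_natM_pi.
by rewrite NegzE mulrNz mulNr sinN sin_natM_pi oppr0.
Qed.

Lemma lebesgue_measure_Omega : mu (@Omega R) = (2 * pi)%:E.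
Proof.
have ltpi : - pi < pi :> R by rewrite gtrN// pi_gt0.
have := @lebesgue_measure_itv R `[- pi, pi].
by rewrite /= lte_fin ltpi -EFinD opprK mulr_natl mulr2n.
Qed.

Lemma cintegral_cexpi (m : int) :
  cintegral (@Omega R) (fun x => cexpi (x * m%:~R)) =
  if m == 0 then (2 * pi)%:C else 0.
Proof.
have ltpi : - pi < pi :> R by rewrite gtrN// pi_gt0.
have [->|m0] := eqVneq m 0.
  under eq_fun do rewrite mulr0.
  apply: complex_ext => /=; rewrite Rintegral_cst// ?cos0 ?sin0 ?mul0r// mul1r.
  exact: (congr1 fine lebesgue_measure_Omega).
have m0' : m%:~R != 0 :> R by rewrite intr_eq0.
apply: complex_ext => /=.
  rewrite (_ : (fun x => _) = fun x => cos (m%:~R * x)); last first.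
    by apply/funext => x; rewrite mulrC.
  have dF (x : R) : is_derive x 1 (fun y => m%:~R^-1 * sin (m%:~R * y))
      (cos (m%:~R * x)).
    have := is_deriveZ (m%:~R^-1 : R) (is_derive_sinM m%:~R x).
    by rewrite /GRing.scale/= mulrA mulVf// mul1r.
  rewrite (integral_derive ltpi (@continuous_cosM R _) dF).
  by rewrite mulrN sinN sin_intM_pi oppr0 subrr.
rewrite (_ : (fun x => _) = fun x => sin (m%:~R * x)); last first.
  by apply/funext => x; rewrite mulrC.
have dF (x : R) : is_derive x 1 (fun y => - m%:~R^-1 * cos (m%:~R * y))
    (sin (m%:~R * x)).
  have := is_deriveZ (- m%:~R^-1 : R) (is_derive_cosM m%:~R x).
  by rewrite /GRing.scale/= mulrA mulrNN mulVf// mul1r.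
rewrite (integral_derive ltpi (@continuous_sinM R _) dF).
by rewrite mulrN cosN subrr.
Qed.

Lemma fourierB (g h : R -> R[i]) (k : int) :
  cintegrable (@Omega R) g -> cintegrable (@Omega R) h ->
  fourier (fun x => g x - h x) k = fourier g k - fourier h k.
Proof.
move=> ig ih; rewrite /fourier -mulrBr; congr (_ * _).
under eq_fun do rewrite mulrDr mulrN -mulN1r.
rewrite cintegralD ?cintegralZ ?mulN1r//; try exact: cintegrable_cexpi.
by apply: cintegrableZ => //; exact: cintegrable_cexpi.
Qed.

Lemma cintegrable_cexpiM (a b k : R) : cintegrable `[a, b] (fun x => cexpi (x * k)).
Proof.
have e : (fun x => x * k) = (fun x => k * x) by apply/funext => x; rewrite mulrC.
by apply: continuous_cintegrable => /= x;
  under eq_fun do rewrite mulrC; [exact: continuous_cosM|exact: continuous_sinM].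
Qed.

Lemma cintegrable_trigonometric_polynomial (s : seq int) (c : int -> R[i]) :
  cintegrable (@Omega R) (fun x => \sum_(j <- s) c j * cexpi (- (x * j%:~R))).
Proof.
apply: cintegrable_sum => // j _; apply: cintegrableZ => //.
by under eq_fun do rewrite -mulrN; exact: cintegrable_cexpiM.
Qed.

Lemma fourier_trigonometric_polynomial (s : seq int) (c : int -> R[i]) (k : int) :
  uniq s ->
  fourier (fun x => \sum_(j <- s) c j * cexpi (- (x * j%:~R))) k =
  if k \in s then c k else 0.
Proof.
move=> us; rewrite /fourier.
under eq_fun do rewrite mulr_sumr.
have E j : (fun x : R => cexpi (x * k%:~R) * (c j * cexpi (- (x * j%:~R)))) =
    (fun x => c j * cexpi (x * (k - j)%:~R)).
  by apply/funext => x; rewrite mulrCA -cexpiD -mulrBr -intrB.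
have iE j : cintegrable (@Omega R) (fun x => c j * cexpi (x * (k - j)%:~R)).
  by apply: cintegrableZ => //; exact: cintegrable_cexpiM.
rewrite cintegral_sum//; last by move=> j _; rewrite E.
rewrite (eq_bigr (fun j => c j * if j == k then (2 * pi)%:C else 0)); last first.
  move=> j _; rewrite E cintegralZ ?cintegral_cexpi ?subr_eq0 1?eq_sym//.
  exact: cintegrable_cexpiM.
have pi0 : (2 * pi)^-1%:C * (2 * pi)%:C = 1 :> R[i].
  by rewrite -rmorphM mulVf// mulf_neq0 ?pnatr_eq0// gt_eqF ?pi_gt0.
have [ks|ks] := boolP (k \in s).
  rewrite (bigD1_seq k)//= eqxx big1 ?addr0; last first.
    by move=> j /negPf ->; rewrite mulr0.
  by rewrite mulrCA pi0 mulr1.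
rewrite big_seq big1 ?mulr0// => j js.
by case: eqVneq ks => [<-|_ _]; [rewrite js|rewrite mulr0].
Qed.

End FourierCoefficients.

(** * Fourier coefficients of the convection equation *)

Section Convection.
Variable R : realType.
Local Open Scope complex_scope.

Local Notation mu := (@lebesgue_measure R).

#[local] Hint Resolve measurable_Omega : core.

Lemma derive_exp_growth (k T : R) (f : R -> R) : 0 < T ->
  {within `[0, T], continuous f} ->
  (forall t, 0 < t < T -> is_derive t 1 f (k * f t)) ->
  f T = expR (k * T) * f 0.
Proof.
move=> T0 cf df.
have dE (t : R) : is_derive t 1 (fun y => expR (- k * y)) (expR (- k * t) * - k).
  exact: (is_derive1_comp (is_derive_expR (- k * t)) (is_derive_mulr (- k) t)).
pose g := (fun y => expR (- k * y)) * f.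
have dg t : t \in `]0, T[ -> is_derive t 1 g 0.
  rewrite in_itv/= => t0T.
  apply: (is_derive_eq (is_deriveM (dE t) (df t t0T))).
  by rewrite /GRing.scale/=; ring.
have cg : {within `[0, T], continuous g}.
  move=> x; apply: cvgM; last exact: cf.
  apply: continuous_subspaceT => y; apply: continuous_comp.
    exact: continuous_mulr.
  exact: continuous_expR.
have [c _] := MVT T0 dg cg.
rewrite mul0r => /eqP; rewrite subr_eq0 => /eqP.
rewrite /g/= !fctE mulr0 expR0 mul1r => <-.
by rewrite mulrA -expRD mulNr subrr expR0 mul1r.
Qed.

Lemma is_derive_trig (k a b x : R) :
  is_derive x 1 (fun y => a * cos (k * y) + b * sin (k * y))
    (b * k * cos (k * x) + - a * k * sin (k * x)).
Proof.
apply: (is_derive_eq (is_deriveD (is_deriveZ a (is_derive_cosM k x))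
  (is_deriveZ b (is_derive_sinM k x)))).
by rewrite /GRing.scale/=; ring.
Qed.

Lemma smooth_trig (k a b : R) :
  smooth (fun y => a * cos (k * y) + b * sin (k * y)).
Proof.
move=> n; suff [c [d ->]] : exists c d, derive1n n
    (fun y => a * cos (k * y) + b * sin (k * y)) =
    fun y => c * cos (k * y) + d * sin (k * y).
  by move=> x; have ? := is_derive_trig k c d x; exact: ex_derive.
elim: n => [|n [c [d IHn]]]; first by exists a, b.
exists (d * k), (- c * k); rewrite derive1nS IHn; apply/funext => x.
by have := is_derive_trig k c d x; rewrite derive1E => ?; rewrite derive_val.
Qed.

Lemma cos_intM_2pi (m : int) : cos (m%:~R * (2 * pi)) = 1 :> R.
Proof.
rewrite mulrCA mulr_natl cos_mulr2n cos2sin2 sin_intM_pi expr0n subr0.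
by rewrite mulr2n addrK.
Qed.

Lemma sin_intM_2pi (m : int) : sin (m%:~R * (2 * pi)) = 0 :> R.
Proof. by rewrite mulrCA mulr_natl sin_mulr2n sin_intM_pi mulr0 mul0rn. Qed.

Lemma periodic_test_cos (m : int) :
  periodic_test (fun x : R => cos (m%:~R * x)).
Proof.
split=> [|x].
  have := @smooth_trig m%:~R 1 0.
  by under eq_fun do rewrite mul1r mul0r addr0.
by rewrite mulrDr cosD cos_intM_2pi sin_intM_2pi mulr1 mulr0 subr0.
Qed.

Lemma periodic_test_sin (m : int) :
  periodic_test (fun x : R => sin (m%:~R * x)).
Proof.
split=> [|x].
  have := @smooth_trig m%:~R 0 1.
  by under eq_fun do rewrite mul1r mul0r add0r.
by rewrite mulrDr sinD cos_intM_2pi sin_intM_2pi mulr1 mulr0 addr0.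
Qed.

Lemma cintegrable_mul_bounded (D : set (measurableTypeR R)) (g : R -> R[i])
    (phi : R -> R) : measurable D -> cintegrable D g -> continuous phi ->
  (forall x, `|phi x| <= 1) -> cintegrable D (fun x => g x * (phi x)%:C).
Proof.
move=> mD [gr gi] cphi phi1; split.
  rewrite (_ : (fun x => _) = fun x => phi x * complex.Re (g x)).
    exact: integrable_mul_bounded.
  by apply/funext => x; rewrite complex_ReM/= mulr0 subr0 mulrC.
rewrite (_ : (fun x => _) = fun x => phi x * complex.Im (g x)).
  exact: integrable_mul_bounded.
by apply/funext => x; rewrite complex_ImM/= mulr0 add0r mulrC.
Qed.

Lemma pairingZ (g : R -> R[i]) (a : R) (phi : R -> R) :
  cintegrable (@Omega R) (fun x => g x * (phi x)%:C) ->
  pairing g (fun x => a * phi x) = a%:C * pairing g phi.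
Proof.
move=> i; rewrite /pairing -cintegralZ//; apply: eq_cintegral => x _.
by rewrite rmorphM mulrCA.
Qed.

Lemma fourier_pairing (g : R -> R[i]) (k : int) : cintegrable (@Omega R) g ->
  fourier g k = (2 * pi)^-1%:C *
    (pairing g (fun x => cos (k%:~R * x)) +
     'i * pairing g (fun x => sin (k%:~R * x))).
Proof.
move=> ig; rewrite /fourier /pairing; congr (_ * _).
have ic : cintegrable (@Omega R) (fun x => g x * (cos (k%:~R * x))%:C).
  apply: cintegrable_mul_bounded => //; first exact: continuous_cosM.
  by move=> x; exact: cos_norm_le1.
have iS : cintegrable (@Omega R) (fun x => g x * (sin (k%:~R * x))%:C).
  apply: cintegrable_mul_bounded => //; first exact: continuous_sinM.
  by move=> x; exact: sin_norm_le1.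
rewrite -cintegralZ// -cintegralD//; last exact: cintegrableZ.
apply: eq_cintegral => x _; rewrite mulrCA -mulrDr mulrC [x * _]mulrC.
congr (_ * _); apply: complex_ext.
  by rewrite complex_ReD complex_ReM/= !mulr0 mul0r subrr addr0.
by rewrite complex_ImD complex_ImM/= mul0r mul1r !add0r.
Qed.

Lemma convection_fourier (T : R) (v0 : R -> R[i]) (v : R -> R -> R[i])
    (k : int) : 0 < T -> convection_solution T v0 v ->
  fourier (v T) k = (expR (k%:~R * T))%:C * fourier v0 k.
Proof.
move=> T0 [vL2 vi vc ve].
have iv t : 0 <= t <= T -> cintegrable (@Omega R) (v t).
  by move=> /vL2; exact: periodic_L2_cintegrable.
have ic t : 0 <= t <= T ->
    cintegrable (@Omega R) (fun x => v t x * (cos (k%:~R * x))%:C).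
  move=> tT; apply: cintegrable_mul_bounded => //; first exact: iv.
    exact: continuous_cosM.
  by move=> x; exact: cos_norm_le1.
have iS t : 0 <= t <= T ->
    cintegrable (@Omega R) (fun x => v t x * (sin (k%:~R * x))%:C).
  move=> tT; apply: cintegrable_mul_bounded => //; first exact: iv.
    exact: continuous_sinM.
  by move=> x; exact: sin_norm_le1.
have derC : derive1 (fun x : R => cos (k%:~R * x)) =
    fun x => - k%:~R * sin (k%:~R * x).
  apply/funext => x; have := is_derive_cosM k%:~R x.
  by rewrite derive1E => ?; rewrite derive_val.
have derS : derive1 (fun x : R => sin (k%:~R * x)) =
    fun x => k%:~R * cos (k%:~R * x).
  apply/funext => x; have := is_derive_sinM k%:~R x.
  by rewrite derive1E => ?; rewrite derive_val.
pose C t := pairing (v t) (fun x => cos (k%:~R * x)).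
pose S t := pairing (v t) (fun x => sin (k%:~R * x)).
have [cCr cCi] := vc _ (periodic_test_cos k).
have [cSr cSi] := vc _ (periodic_test_sin k).
pose f t := complex.Re (C t) - complex.Im (S t).
pose h t := complex.Im (C t) + complex.Re (S t).
have CSE t : C t + 'i * S t = f t +i* h t.
  by apply: complex_ext; rewrite ?complex_ReD ?complex_ImD ?complex_ReM
    ?complex_ImM /= ?mul0r ?mul1r ?add0r.
have dt t : 0 < t < T -> is_derive t 1 f (k%:~R * f t) /\
    is_derive t 1 h (k%:~R * h t).
  move=> tT; have tT' : 0 <= t <= T by case/andP: tT => /ltW -> /ltW ->.
  have [dCr dCi] := ve _ (periodic_test_cos k) t tT.
  have [dSr dSi] := ve _ (periodic_test_sin k) t tT.
  move: dCr dCi dSr dSi; rewrite derC derS !pairingZ; [|exact: ic|exact: iS].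
  rewrite -/(C t) -/(S t) => dCr dCi dSr dSi; split.
    apply: (is_derive_eq (is_deriveB dCr dSi)).
    by rewrite /f; case: (C t) (S t) => [a b] [c d] /=; ring.
  apply: (is_derive_eq (is_deriveD dCi dSr)).
  by rewrite /h; case: (C t) (S t) => [a b] [c d] /=; ring.
have cf : {within `[0, T], continuous f}.
  by move=> x; apply: cvgB; [exact: cCr|exact: cSi].
have ch : {within `[0, T], continuous h}.
  by move=> x; apply: cvgD; [exact: cCi|exact: cSr].
have fT := derive_exp_growth T0 cf (fun t tT => (dt t tT).1).
have hT := derive_exp_growth T0 ch (fun t tT => (dt t tT).2).
have v0E : v 0 = v0 by apply/funext => x.
rewrite -v0E !fourier_pairing; first last.
- by apply: iv; rewrite lexx ltW.
- by apply: iv; rewrite lexx ltW.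
rewrite -/(C T) -/(S T) -/(C 0) -/(S 0) !CSE fT hT mulrCA; congr (_ * _).
by apply: complex_ext; rewrite ?complex_ReM ?complex_ImM/= ?mul0r ?subr0 ?addr0.
Qed.

End Convection.

(** * Frequency truncation *)

Section Truncation.
Variable R : realType.
Local Open Scope complex_scope.

Local Notation mu := (@lebesgue_measure R).

Lemma finite_int_ball (e : R) : finite_set [set k : int | `|k%:~R : R| <= e].
Proof.
pose n := Num.bound `|e|.
apply: (@sub_finite_set _ _
    ((Posz @` `I_n) `|` ((fun m : nat => - Posz m) @` `I_n))).
  move=> k /= ke.
  have kn : (`|k| < n)%N.
    rewrite -(ltr_nat R) natr_absz intr_norm.
    by rewrite (le_lt_trans ke)// (le_lt_trans (ler_norm e))// archi_boundP.
  case: (intP k) kn => [|m|m] kn; [left|left|right].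
  - by exists 0%N.
  - by exists m.+1.
  - by exists m.+1.
by rewrite finite_setU; split; exact/finite_image/finite_II.
Qed.

Lemma exp_tail (p a : R) : a < p ->
  mu.-integrable `]p, +oo[ (EFin \o (fun q => expR (- `|q - a|))) /\
  Rintegral mu `]p, +oo[ (fun q => expR (- `|q - a|)) = expR (a - p).
Proof.
move=> ap; pose f q : R := expR a * expR (- q).
have dN (q : R) : is_derive q 1 (fun x => expR (- x)) (- expR (- q)).
  have := is_derive1_comp (is_derive_expR (- q)) (is_deriveN (is_derive_id q 1)).
  by rewrite mulrN1.
have dF (q : R) : is_derive q 1 (fun x => - f x) (f q).
  apply: (is_derive_eq (is_deriveN (is_deriveZ (expR a) (dN q)))).
  by rewrite /GRing.scale/= mulrN opprK.
have cf : continuous f.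
  move=> q; apply: cvgM; first exact: cvg_cst.
  by apply: continuous_comp; [exact: continuousN|exact: continuous_expR].
have cF : continuous (fun x => - f x).
  by move=> q; apply: differentiable_continuous; apply/derivable1_diffP.
have f0 q : 0 <= f q by rewrite mulr_ge0 ?expR_ge0.
have If : (\int[mu]_(x in `[p, +oo[) (f x)%:E = (f p)%:E)%E.
  rewrite (@ge0_continuous_FTC2y _ f (fun x => - f x) p 0)//.
  - by rewrite EFinN oppeK add0e.
  - exact: continuous_subspaceT.
  - rewrite -oppr0; apply: cvgN; rewrite -[X in _ --> X](mulr0 (expR a)).
    by apply: cvgM; [exact: cvg_cst|exact: cvgr_expR].
  - by apply: cvg_at_right_filter; exact: cF.
  - by move=> q _; rewrite derive1E derive_val.
have mf D : measurable_fun (D : set (measurableTypeR R)) f.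
  by apply: measurable_funTS; exact: measurable_realfun.continuous_measurable_fun.
have mI : measurable (`[p, +oo[ : set (measurableTypeR R)).
  exact: measurable_itv.
have mI' : measurable (`]p, +oo[ : set (measurableTypeR R)).
  exact: measurable_itv.
have fi : mu.-integrable `[p, +oo[ (EFin \o f).
  apply/integrableP; split.
    by apply/measurable_realfun.measurable_EFinP; exact: mf.
  under eq_integral do rewrite /= ger0_norm//.
  by rewrite If ltry.
have fi' : mu.-integrable `]p, +oo[ (EFin \o f).
  apply: (integrableS mI mI' _ fi).
  by move=> q /=; rewrite !in_itv/= !andbT => /ltW.
have fE : {in `]p, +oo[%classic, f =1 fun q => expR (- `|q - a|)}.
  move=> q; rewrite inE/= in_itv/= andbT => pq.
  by rewrite ger0_norm ?subr_ge0 ?(ltW (lt_trans ap pq))// opprB expRD.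
split.
  by apply: eq_integrable fi' => // q /fE /= ->.
transitivity (Rintegral mu `]p, +oo[ f).
  by apply/esym/eq_Rintegral; exact: fE.
by rewrite Rintegral_itv_obnd_cbnd// /Rintegral If /= expRD.
Qed.

Lemma cintegral_exp_tail (p a : R) : a < p ->
  cintegrable `]p, +oo[ (fun q => (expR (- `|q - a|))%:C) /\
  cintegral `]p, +oo[ (fun q => (expR (- `|q - a|))%:C) = (expR (a - p))%:C.
Proof.
move=> /exp_tail[fi If].
have mI : measurable (`]p, +oo[ : set (measurableTypeR R)).
  exact: measurable_itv.
split; first by split => //=; exact: integrable0.
by apply: complex_ext => //=; rewrite Rintegral_cst// mul0r.
Qed.

Lemma truncated_solutionE (T eta_max : R) (v0 : R -> R[i])
    (u : R -> R -> R -> R[i]) (x p : R) : 0 < T ->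
  truncated_solution T eta_max v0 u -> eta_max * T < p ->
  u T x p =
    \sum_(k <- fset_set [set k : int | `|k%:~R : R| <= eta_max])
      ((expR (k%:~R * T))%:C * fourier v0 k) * cexpi (- (x * k%:~R)).
Proof.
move=> T0 hu hp; have fK := finite_int_ball eta_max.
have Tp k : k \in fset_set [set k : int | `|k%:~R : R| <= eta_max] ->
    k%:~R * T < p.
  rewrite in_fset_set// inE/= => /(le_trans (ler_norm _)) ke.
  by rewrite (le_lt_trans _ hp)// ler_wpM2r// ltW.
have TT : 0 <= T <= T by rewrite lexx ltW.
have expp (a : R) : (expR p)%:C * (expR (a - p))%:C = (expR a)%:C.
  by rewrite -rmorphM -expRD addrC subrK.
case: hu => -> //.
  rewrite /recover_point /w_trunc fsbig_finite// mulr_sumr.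
  apply: eq_big_seq => k /Tp kp; rewrite !mulrA; congr (_ * _ * _).
  by rewrite ger0_norm ?subr_ge0 ?ltW// opprB expp.
rewrite /recover_integral.
have wE q : w_trunc eta_max v0 T x q =
    \sum_(k <- fset_set [set k : int | `|k%:~R : R| <= eta_max])
      ((expR (- `|q - k%:~R * T|))%:C * fourier v0 k * cexpi (- (x * k%:~R))).
  by rewrite /w_trunc fsbig_finite.
rewrite (funext wE).
have mI : measurable (`]p, +oo[ : set (measurableTypeR R)).
  exact: measurable_itv.
have E k : (fun q => (expR (- `|q - k%:~R * T|))%:C * fourier v0 k *
      cexpi (- (x * k%:~R))) =
    (fun q => (fourier v0 k * cexpi (- (x * k%:~R))) *
      (expR (- `|q - k%:~R * T|))%:C).
  by apply/funext => q; rewrite -mulrA mulrC.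
rewrite cintegral_sum//; last first.
  by move=> k /Tp /cintegral_exp_tail[ki _]; rewrite E; exact: cintegrableZ.
rewrite mulr_sumr; apply: eq_big_seq => k /Tp /cintegral_exp_tail[ki kI].
by rewrite E cintegralZ// kI mulrCA expp mulrC mulrA.
Qed.

Lemma esum_le_scale (I : choiceType) (A : set I) (f g : I -> R) (c : R) :
  0 <= c -> (forall i, 0 <= g i) -> (forall i, A i -> f i <= c * g i) ->
  (\esum_(i in A) (f i)%:E <= c%:E * \esum_(i in A) (g i)%:E)%E.
Proof.
move=> c0 g0 fg; apply: ge_ereal_sup => _ [X [finX XA] <-].
apply: (@le_trans _ _ (c%:E * (\sum_(i \in X) (g i)%:E)%R)%E).
  rewrite ge0_mule_fsumr; last by move=> i; rewrite lee_fin.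
  by apply: lee_fsum => // i /XA /fg; rewrite -EFinM lee_fin.
apply: lee_wpmul2l; first by rewrite lee_fin.
by apply: ereal_sup_ubound; exists X.
Qed.

Lemma Hnorm_truncation (A : set int) (s eta : R) (g e : R -> R[i]) :
  0 < eta -> 0 <= s ->
  (forall k, A k -> eta < `|k%:~R : R|) ->
  (forall k, A k -> fourier e k = fourier g k) ->
  (forall k, ~ A k -> fourier e k = 0) ->
  (L2norm e <= Hnorm_on A s g * ((eta `^ s)^-1)%:E)%E.
Proof.
move=> eta0 s0 Aeta Ae Ne.
have es0 : 0 < eta `^ s by exact: powR_gt0.
pose c := (eta `^ s)^-1 ^+ 2.
have c0 : 0 <= c by rewrite sqr_ge0.
have cE : ((eta `^ s)^-1)%:E = (c%:E `^ 2^-1)%E.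
  rewrite poweR_EFin powR12_sqrt// sqrtr_sqr ger0_norm// invr_ge0.
  exact: ltW.
pose G k := Normc.normc (fourier g k) ^+ 2 * (1 + k%:~R ^+ 2) `^ s.
have G0 k : 0 <= G k by rewrite mulr_ge0 ?sqr_ge0 ?powR_ge0.
have S0 : (0 <= \esum_(k in A) (G k)%:E)%E.
  by apply: esum_ge0 => k _; rewrite lee_fin.
rewrite /L2norm /Hnorm /Hnorm_on cE -poweRM// ?lee_fin//.
have -> : (\esum_(k in [set: int])
    (Normc.normc (fourier e k) ^+ 2 * (1 + k%:~R ^+ 2) `^ 0)%:E =
    \esum_(k in A) (Normc.normc (fourier g k) ^+ 2)%:E :> \bar R)%E.
  rewrite [RHS]esum_mkcond; apply: eq_esum => k _.
  rewrite powRr0 mulr1; case: ifPn => [|/negP]; rewrite inE => Ak.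
    by rewrite Ae.
  by rewrite Ne// Normc.normc0 expr0n.
apply: gt0_ler_poweR; rewrite ?invr_ge0// ?in_itv/= ?leey ?andbT.
- by apply: esum_ge0 => k _; rewrite lee_fin sqr_ge0.
- by rewrite mule_ge0// lee_fin.
rewrite muleC; apply: esum_le_scale => // k Ak.
rewrite mulrCA ler_peMr ?sqr_ge0// /c exprVn ler_pdivlMl ?exprn_gt0// mulr1.
rewrite -powR_mulrn ?powR_ge0// -powRrM mulrC powRrM powR_mulrn ?(ltW eta0)//.
apply: ge0_ler_powR; rewrite ?nnegrE ?addr_ge0 ?sqr_ge0//.
rewrite -[leLHS]add0r -(@real_normK _ k%:~R) ?num_real//.
by rewrite lerD ?ler01// lerXn2r ?nnegrE ?(ltW eta0)// ltW// Aeta.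
Qed.

End Truncation.

Theorem theorem5p1 (R : realType) (T s eta_max bound : R)
    (v0 : R -> R[i]) (v : R -> R -> R[i]) (w u : R -> R -> R -> R[i])
    (hT : 0 < T) (hs : 0 <= s)
    (hv : convection_solution T v0 v)
    (hw : schrodingerised_solution T v0 w)
    (hbound : (Hnorm s (v T) <= bound%:E)%E)
    (heta : 0 < eta_max)
    (hu : truncated_solution T eta_max v0 u)
    (p : R) (hp : eta_max * T < p) :
  (L2norm (fun x => (v T x - u T x p)%R)
     <= delta s (v T) eta_max * ((eta_max `^ s)^-1)%:E)%E /\
  ((forall k : int, k%:~R < - eta_max -> fourier v0 k = 0) ->
   (L2norm (fun x => (v T x - u T x p)%R)
      <= delta_right s (v T) eta_max * ((eta_max `^ s)^-1)%:E)%E).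
Proof.
have ivT : cintegrable (@Omega R) (v T).
  by apply/periodic_L2_cintegrable/(convection_L2 hv); rewrite lexx ltW.
have vT k := convection_fourier k hT hv.
have eE k : fourier (fun x => v T x - u T x p) k =
    if `|k%:~R : R| <= eta_max then 0 else fourier (v T) k.
  under eq_fun do rewrite (truncated_solutionE _ hT hu hp).
  rewrite fourierB//; last first.
    exact: cintegrable_trigonometric_polynomial.
  rewrite fourier_trigonometric_polynomial ?fset_uniq//.
  rewrite in_fset_set; last exact: finite_int_ball.
  have -> : (k \in [set k : int | `|k%:~R : R| <= eta_max]) =
      (`|k%:~R : R| <= eta_max) by apply/idP/idP; rewrite inE.
  by case: ifP => _; rewrite ?subr0// vT subrr.
split=> [|v0_left].
  apply: Hnorm_truncation => // k /=; rewrite eE.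
    by rewrite ltNge => /negPf ->.
  by move=> /negP; rewrite -leNgt => ->.
apply: Hnorm_truncation => // k /=.
- by move=> /lt_le_trans; apply; exact: ler_norm.
- by move=> ek; rewrite eE leNgt (lt_le_trans ek (ler_norm _)).
move=> /negP; rewrite -leNgt eE => ke; case: ifPn => // nk.
rewrite vT v0_left ?mulr0//; apply: contraNT nk; rewrite -leNgt => ek.
by rewrite ler_norml ek.
Qed.
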